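(* Let $X \in \mathbb{R}^{m \times n}$ with $m \leq n$ and $\operatorname{rank} X = m$, let $c \geq 1$, and let $\mathcal{S}_0 \subseteq \{1,\dots,n\}$ be a starting index set with $|\mathcal{S}_0| = k \geq m$ and $\operatorname{rank} X_{\mathcal{S}_0} = m$. Let $\mathcal{S}$ be the set returned by the Dominant-split algorithm (described in the context) run on $X$, $\mathcal{S}_0$, $c$. Then $$\|X_{\mathcal{S}}^{\dagger} X\|_F^2 \leq m + \frac{m + (c^2 - 1)k}{k - m + 1}(n - k), \qquad \|X_{\mathcal{S}}^{\dagger} X\|_2^2 \leq 1 + \frac{m + (c^2 - 1)k}{k - m + 1}(n - k).$$ Additionally, if $\mathcal{S}_0$ contains an index set $\mathcal{I}$ of cardinality $m$ chosen by CPQR applied to $X$, and $c > 1$, then the Dominant-split algorithm requires no more than $O(nm^2 \log_c k)$ operations.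
   Context: Notation: $X_{\mathcal{S}}$ is the submatrix of $X$ formed by the columns with indices in $\mathcal{S}$; $x_j$ is the $j$-th column of $X$; $X_{\mathcal{S}}^{\dagger}$ is the Moore–Penrose pseudoinverse; $\|\cdot\|_F$ and $\|\cdot\|_2$ are the Frobenius and spectral norms; $\mathcal{S}+s-r = (\mathcal{S}\cup\{s\})\setminus\{r\}$. CPQR (column pivoted QR) applied to $X$: iteratively, $m$ times, select the column which has the largest component (in Euclidean norm) orthogonal to the already selected columns. The set of the $m$ selected indices is $\mathcal{I}$. Dominant-split algorithm. Input: $X\in\mathbb{R}^{m\times n}$ ($m\le n$) of rank $m$, a starting set $\mathcal{S}\subseteq\{1,\dots,n\}$ with $|\mathcal{S}|=k\ge m$ and $\operatorname{rank}X_{\mathcal{S}}=m$, and $c\ge 1$. 1. (Optional, for numerical stability) Compute the LQ decomposition $X = LQ$, where $L \in \mathbb{R}^{m\times m}$ and $Q \in \mathbb{R}^{m \times n}$ has orthonormal rows, and replace $X$ by $Q$. 2. Set $Y \gets (X_{\mathcal{S}}X_{\mathcal{S}}^T)^{-1}$ and $l_j \gets x_j^T Y x_j$ for $j=1,\dots,n$. 3. Loop: (a) select $s \in \operatorname{argmax}_{j\notin\mathcal{S}} l_j$; (b) set $l'_j \gets l_j - (x_s^T Y x_j)^2/(1+l_s)$ for all $j$, and $Y' \gets Y - Yx_sx_s^TY/(1+l_s)$; (c) select $r \in \operatorname{argmin}_{j\in\mathcal{S}} l'_j$; (d) if $(1+l_s)(1-l'_r) \le c^2$, stop and return $\mathcal{S}$;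 (e) otherwise set $\mathcal{S}\gets \mathcal{S}+s-r$, $l_j \gets l'_j + (x_r^TY'x_j)^2/(1-l'_r)$ for all $j$, and $Y \gets Y' + Y'x_rx_r^TY'/(1-l'_r)$.
   Formalization: The operation bound is proved as C·n·m²·max(1, log_c k) with an absolute constant C, since the literal bound with log_c k fails when k = 1 (log_c k = 0) or c is much larger than k; m ≥ 1 is assumed. *)

(* Defs.v *)
From HB Require Import structures.
From mathcomp Require Import all_boot all_order all_algebra.
From mathcomp Require Import all_classical all_reals all_analysis.

Set Implicit Arguments.
Unset Strict Implicit.
Unset Printing Implicit Defensive.

Import Order.TTheory GRing.Theory Num.Theory.
Local Open Scope ring_scope.

Section Matrices.
Variable R : realType.

(* The columns with index in S, in increasing order of index. *)
Definition colset m n (X : 'M[R]_(m, n)) (S : {set 'I_n}) : 'M[R]_(m, #|S|) :=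
  colsub enum_val X.

Definition frobenius m n (A : 'M[R]_(m, n)) : R :=
  Num.sqrt (\sum_i \sum_j A i j ^+ 2).

(* The operator norm for the Euclidean norms; on a column vector [frobenius]
   is the Euclidean norm (the library's norm on matrices is the max norm). *)
Definition spectral m n (A : 'M[R]_(m, n)) : R :=
  sup [set frobenius (A *m v) | v in [set v : 'cV[R]_n | frobenius v <= 1]]%classic.

Definition penrose m n (A : 'M[R]_(m, n)) (P : 'M[R]_(n, m)) : Prop :=
  [/\ A *m P *m A = A, P *m A *m P = P,
      (A *m P)^T = A *m P & (P *m A)^T = P *m A].

(* The Moore-Penrose pseudoinverse. It is not [pinvmx], which is only some
   generalized inverse. Existence and uniqueness are [mppinvP] and
   [penrose_unique]. *)
Definition mppinv m n (A : 'M[R]_(m, n)) : 'M[R]_(n, m) :=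
  xget 0 [set P | penrose A P]%classic.

Lemma penrose_unique m n (A : 'M[R]_(m, n)) P Q :
  penrose A P -> penrose A Q -> P = Q.
Proof.
move=> [P1 P2 P3 P4] [Q1 Q2 Q3 Q4].
have APQ : A *m P = A *m Q.
  rewrite -P3 -{1}Q1 -mulmxA trmx_mul P3 Q3.
  by rewrite mulmxA P1.
have PQA : P *m A = Q *m A.
  rewrite -P4 -{1}Q1 !mulmxA -(mulmxA (P *m A)) trmx_mul P4 Q4.
  by rewrite -mulmxA (mulmxA A P A) P1.
by rewrite -P2 -mulmxA APQ mulmxA PQA Q2.
Qed.

Lemma gram_unitmx r n (B : 'M[R]_(r, n)) : row_free B -> B *m B^T \in unitmx.
Proof.
move=> Bfree; rewrite -row_free_unit -kermx_eq0; apply/rowV0P => v.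
move/sub_kermxP => vBB; have vB : v *m B = 0.
  have : (v *m B) *m (v *m B)^T = 0.
    by rewrite trmx_mul mulmxA -(mulmxA v) vBB mul0mx.
  move/matrixP/(_ 0 0); rewrite !mxE => /eqP.
  rewrite psumr_eq0 => [/allP h|j _]; last by rewrite !mxE -expr2 sqr_ge0.
  apply/rowP => j; have := h j (mem_index_enum _).
  by rewrite !mxE -expr2 sqrf_eq0 => /eqP.
by apply: (row_free_inj Bfree); rewrite vB mul0mx.
Qed.

Lemma penrose_exists m n (A : 'M[R]_(m, n)) : exists P, penrose A P.
Proof.
have [r [C [B [AE uB uC]]]] : exists r (C : 'M[R]_(m, r)) (B : 'M[R]_(r, n)),
    [/\ A = C *m B, B *m B^T \in unitmx & C^T *m C \in unitmx].
  exists (\rank A), (col_base A), (row_base A); split.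
  - by rewrite mulmx_base.
  - by apply: gram_unitmx; exact: row_base_free.
  - rewrite -{2}(trmxK (col_base A)); apply: gram_unitmx.
    by rewrite /row_free mxrank_tr; exact: col_base_full.
pose P := B^T *m invmx (B *m B^T) *m invmx (C^T *m C) *m C^T; exists P.
have AP : A *m P = C *m invmx (C^T *m C) *m C^T.
  rewrite AE /P !mulmxA -(mulmxA C B) -(mulmxA C _ (invmx _)).
  by rewrite mulmxV // mulmx1.
have PA : P *m A = B^T *m invmx (B *m B^T) *m B.
  rewrite AE /P -!mulmxA (mulmxA C^T C) (mulmxA (invmx (C^T *m C))).
  by rewrite mulVmx // mul1mx.
split.
- rewrite AP AE -!mulmxA (mulmxA C^T C) (mulmxA (invmx (C^T *m C))).
  by rewrite mulVmx // mul1mx.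
- rewrite PA {1}/P !mulmxA -(mulmxA _ B) -(mulmxA _ (B *m B^T)).
  by rewrite mulmxV // mulmx1.
- by rewrite AP !trmx_mul trmxK trmx_inv trmx_mul trmxK mulmxA.
- by rewrite PA !trmx_mul trmxK trmx_inv trmx_mul trmxK mulmxA.
Qed.

Lemma mppinvP m n (A : 'M[R]_(m, n)) : penrose A (mppinv A).
Proof.
have [P AP] := penrose_exists A.
exact: (xgetI (P := [set P | penrose A P]%classic) 0 AP).
Qed.

End Matrices.

Section CPQR.
Variables (R : realType) (m n : nat) (X : 'M[R]_(m, n)).

(* The component of [x_j] orthogonal to the columns with index in J:
   [A *m mppinv A] is the orthogonal projector onto the range of A. *)
Definition orth_comp (J : {set 'I_n}) (j : 'I_n) : 'cV[R]_m :=
  col j X - colset X J *m mppinv (colset X J) *m col j X.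

(* [cpqr t J]: J can be the set of the first t selected indices, whatever
   the way ties are broken. *)
Inductive cpqr : nat -> {set 'I_n} -> Prop :=
| cpqr_nil : cpqr 0 finset.set0
| cpqr_select t (J : {set 'I_n}) (s : 'I_n) :
    cpqr t J -> s \notin J ->
    (forall j, j \notin J ->
       frobenius (orth_comp J j) <= frobenius (orth_comp J s)) ->
    cpqr t.+1 (s |: J).

End CPQR.

(* A computation is its result paired with the number of operations executed:
   arithmetic operations, square roots and comparisons of real numbers count
   1 each; data movement (transposition, extraction and assembly of blocks,
   index sets) is free. *)
Definition counted (T : Type) : Type := (T * nat)%type.

Definition cret T (x : T) : counted T := (x, 0).
Definition cbind T U (e : counted T) (f : T -> counted U) : counted U :=
  ((f e.1).1, e.2 + (f e.1).2)%N.
Definition ctick (k : nat) : counted unit := (tt, k).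

Notation "'let*' x ':=' e 'in' f" := (cbind e (fun x => f))
  (at level 200, x name, e at level 200, f at level 200).

Section CountedOperations.
Variable R : realType.

Definition cadd (x y : R) : counted R := (x + y, 1).
Definition csub (x y : R) : counted R := (x - y, 1).
Definition cmul (x y : R) : counted R := (x * y, 1).
Definition cdiv (x y : R) : counted R := (x / y, 1).
Definition csqrt (x : R) : counted R := (Num.sqrt x, 1).
Definition cle (x y : R) : counted bool := (x <= y, 1).

(* Each term is computed, then added to an accumulator. *)
Definition csum p (f : 'I_p -> counted R) : counted R :=
  (\sum_i (f i).1, (\sum_i (f i).2.+1)%N).

Definition cmx p q (f : 'I_p -> 'I_q -> counted R) : counted 'M[R]_(p, q) :=
  (\matrix_(i, j) (f i j).1, (\sum_i \sum_j (f i j).2)%N).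

Definition csubmx p q (A B : 'M[R]_(p, q)) : counted 'M[R]_(p, q) :=
  cmx (fun i j => csub (A i j) (B i j)).
Definition cdivmx p q (A : 'M[R]_(p, q)) (d : R) : counted 'M[R]_(p, q) :=
  cmx (fun i j => cdiv (A i j) d).
Definition cmulmx p q r (A : 'M[R]_(p, q)) (B : 'M[R]_(q, r)) :
    counted 'M[R]_(p, r) :=
  cmx (fun i j => csum (fun k => cmul (A i k) (B k j))).

(* LQ decomposition by the modified Gram-Schmidt process on the rows. *)
Fixpoint clq m n : 'M[R]_(m, n) -> counted ('M[R]_m * 'M[R]_(m, n)) :=
  match m return 'M[R]_(m, n) -> counted ('M[R]_m * 'M[R]_(m, n)) with
  | 0 => fun X => cret (0, X)
  | m'.+1 => fun X : 'M[R]_(1 + m', n) =>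
    let x := usubmx X in
    let B := dsubmx X in
    let* xx := cmulmx x x^T in
    let* rho := csqrt (xx 0 0) in
    let* q := cdivmx x rho in
    let* r := cmulmx B q^T in
    let* rq := cmulmx r q in
    let* B' := csubmx B rq in
    let* LQ := clq B' in
    cret (block_mx rho%:M 0 r LQ.1 : 'M[R]_(1 + m'),
          col_mx q LQ.2 : 'M[R]_(1 + m', n))
  end.

(* Inverse of a positive definite matrix by elimination of the first row and
   column: the inverse of [block_mx a b c D] is assembled from a and the
   inverse T of the Schur complement [D - c *m (b / a)]. *)
Fixpoint cinvmx m : 'M[R]_m -> counted 'M[R]_m :=
  match m return 'M[R]_m -> counted 'M[R]_m with
  | 0 => fun A => cret A
  | m'.+1 => fun A : 'M[R]_(1 + m') =>
    let a := ulsubmx A 0 0 in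
    let* u := cdivmx (ursubmx A) a in
    let* w := cdivmx (dlsubmx A) a in
    let* cu := cmulmx (dlsubmx A) u in
    let* D' := csubmx (drsubmx A) cu in
    let* T := cinvmx D' in
    let* v := cmulmx u T in
    let* z := cmulmx T w in
    let* vw := cmulmx v w in
    let* a' := cdiv 1 a in
    let* e := cadd a' (vw 0 0) in
    let* v' := csubmx 0 v in
    let* z' := csubmx 0 z in
    cret (block_mx e%:M v' z' T : 'M[R]_(1 + m'))
  end.

End CountedOperations.

(* State of the Dominant-split loop: the current set S, the scores
   l_j = x_j^T Y x_j of all the columns, and Y = (X_S X_S^T)^-1. *)
Record state (R : realType) (m n : nat) := State {
  indices : {set 'I_n};
  lev : 'rV[R]_n;
  invgram : 'M[R]_m
}.

Section DominantSplit.
Variables (R : realType) (m n : nat).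

Definition argmax_on (P : {set 'I_n}) (l : 'rV[R]_n) (s : 'I_n) : Prop :=
  s \in P /\ forall j, j \in P -> l 0 j <= l 0 s.

Definition argmin_on (P : {set 'I_n}) (l : 'rV[R]_n) (r : 'I_n) : Prop :=
  r \in P /\ forall j, j \in P -> l 0 r <= l 0 j.

(* The boolean tells whether X is first replaced by the factor Q of its LQ
   decomposition, which is optional. The first component of the result is the
   matrix the loop works on. *)
Definition start (lq : bool) (X : 'M[R]_(m, n)) (S : {set 'I_n}) :
    counted ('M[R]_(m, n) * state R m n) :=
  let* X := if lq then let* LQ := clq X in cret LQ.2 else cret X in
  let* G := cmulmx (colset X S) (colset X S)^T in
  let* Y := cinvmx G in
  let* l := cmx (fun _ j =>
      let* y := cmulmx Y (col j X) in
      let* t := cmulmx (col j X)^T y in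
      cret (t 0 0)) in
  cret (X, State S l Y).

Variables (X : 'M[R]_(m, n)) (c : R).

(* The scores l' and the inverse Y' for S + s; w_j is x_s^T Y x_j. *)
Definition insert (st : state R m n) (s : 'I_n) :
    counted ('rV[R]_n * 'M[R]_m) :=
  let l := lev st in
  let Y := invgram st in
  let* d := cadd 1 (l 0 s) in
  let* y := cmulmx Y (col s X) in
  let* z := cmulmx (col s X)^T Y in
  let* w := cmulmx z X in
  let* l' := cmx (fun _ j =>
      let* ww := cmul (w 0 j) (w 0 j) in
      let* q := cdiv ww d in
      csub (l 0 j) q) in
  let* yz := cmulmx y z in
  let* D := cdivmx yz d in
  let* Y' := csubmx Y D in
  cret (l', Y').

(* The next state, for S + s - r, given the scores l' and the inverse Y' for
   S + s; w_j is x_r^T Y' x_j. *)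
Definition remove (S : {set 'I_n}) (l' : 'rV[R]_n) (Y' : 'M[R]_m)
    (s r : 'I_n) : counted (state R m n) :=
  let* d := csub 1 (l' 0 r) in
  let* y := cmulmx Y' (col r X) in
  let* z := cmulmx (col r X)^T Y' in
  let* w := cmulmx z X in
  let* l := cmx (fun _ j =>
      let* ww := cmul (w 0 j) (w 0 j) in
      let* q := cdiv ww d in
      cadd (l' 0 j) q) in
  let* yz := cmulmx y z in
  let* D := cdivmx yz d in
  let* Y := cmx (fun i j => cadd (Y' i j) (D i j)) in
  cret (State ((s |: S) :\ r) l Y).

(* One pass through the loop body, s being the index selected for insertion
   and r the one for removal: the set returned or the next state. Each of the
   two selections is charged as a scan of the n indices. *)
Definition body (st : state R m n) (s r : 'I_n) :
    counted ({set 'I_n} + state R m n) :=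
  let* _ := ctick n in
  let* up := insert st s in
  let* _ := ctick n in
  let* d := cadd 1 (lev st 0 s) in
  let* e := csub 1 (up.1 0 r) in
  let* de := cmul d e in
  let* cc := cmul c c in
  let* stop := cle de cc in
  if stop then cret (inl (indices st))
  else let* st' := remove (indices st) up.1 up.2 s r in cret (inr st').

(* [iteration st out N]: the loop body executed in state st can have outcome
   out after N operations. Ties in the selections are broken arbitrarily.
   If S is the whole index set, there is no candidate for insertion and S is
   returned. *)
Definition iteration (st : state R m n) (out : {set 'I_n} + state R m n)
    (N : nat) : Prop :=
  if indices st == [set: 'I_n] then (out, N) = (inl (indices st), n)
  else exists s r,
    [/\ argmax_on (~: indices st) (lev st) s,
        argmin_on (indices st) (insert st s).1.1 r
      & (out, N) = body st s r].

Inductive loop (st : state R m n) (S : {set 'I_n}) : nat -> Prop :=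
| loop_stop N : iteration st (inl S) N -> loop st S N
| loop_swap st' N N' :
    iteration st (inr st') N -> loop st' S N' -> loop st S (N + N').

(* However ties are broken, the loop reaches a return statement. *)
Inductive loop_halts (st : state R m n) : Prop :=
| Loop_halts :
    (exists out N, iteration st out N) ->
    (forall st' N, iteration st (inr st') N -> loop_halts st') ->
    loop_halts st.

End DominantSplit.

Section Run.
Variables (R : realType) (m n : nat) (lq : bool) (X : 'M[R]_(m, n)).
Variables (S0 : {set 'I_n}) (c : R).

(* The algorithm can return S after N operations in total. *)
Definition dominant_split (S : {set 'I_n}) (N : nat) : Prop :=
  let init := start lq X S0 in
  exists2 N', loop init.1.1 c init.1.2 S N' & N = (init.2 + N')%N.

Definition dominant_split_halts : Prop :=
  let init := start lq X S0 in loop_halts init.1.1 c init.1.2.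

End Run.

Definition log_base (R : realType) (c x : R) : R := ln x / ln c.

(* Main.v *)
Require Import Defs.
From mathcomp Require Import all_boot all_order all_algebra.
From mathcomp Require Import all_classical all_reals all_analysis.
From mathcomp Require Import ring lra zify.

(* Write G = X_S X_S^T. Replacing S by S + s - r multiplies det G by
   (1 + l_s)(1 - l'_r), which exceeds c^2 >= 1 at every swap: since there are
   finitely many sets S, the loop halts. When it stops, summing
   (1 + l_s)(1 - l'_i) <= c^2 over i in S bounds every l_j with j outside S,
   hence the Frobenius norm, as ||X_S^+ x_j||^2 = l_j; for the spectral norm,
   X_S^+ X_S is an orthogonal projector. Replacing X by Q changes neither the
   l_j nor X_S^+ X.

   For the number of swaps, the CPQR normals scaled by their squared norms give
   a matrix U such that the entries of U X are at most 1 in absolute value and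
   det (U X_I X_I^T U^T) = 1. Hadamard's inequality then yields
   det (X_S X_S^T) <= k^m det (X_S0 X_S0^T) for every S of size k, so there are
   at most m log_c(k) / 2 swaps, each costing O(nm). *)

Set Implicit Arguments.
Unset Strict Implicit.
Unset Printing Implicit Defensive.

Import Order.TTheory GRing.Theory Num.Theory.
Local Open Scope ring_scope.

(** * Inner products, Schur complements, rank-one updates and Hadamard's inequality *)

Section LinearAlgebra.
Variable R : realType.

Definition dot m (u v : 'cV[R]_m) : R := (u^T *m v) 0 0.

Lemma dotE m (u v : 'cV[R]_m) : dot u v = \sum_i u i 0 * v i 0.
Proof. by rewrite /dot mxE; apply: eq_bigr => i _; rewrite mxE. Qed.

Lemma dot_scalar_mx m (u v : 'cV[R]_m) : u^T *m v = (dot u v)%:M.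
Proof. exact: mx11_scalar. Qed.

Lemma dotC m (u v : 'cV[R]_m) : dot u v = dot v u.
Proof. by rewrite !dotE; apply: eq_bigr => i _; rewrite mulrC. Qed.

Lemma dotDr m (u v w : 'cV[R]_m) : dot u (v + w) = dot u v + dot u w.
Proof. by rewrite /dot mulmxDr mxE. Qed.

Lemma dotBr m (u v w : 'cV[R]_m) : dot u (v - w) = dot u v - dot u w.
Proof. by rewrite /dot mulmxBr !mxE. Qed.

Lemma dotZr m (u v : 'cV[R]_m) a : dot u (a *: v) = a * dot u v.
Proof. by rewrite /dot -scalemxAr mxE. Qed.

Lemma dot0r m (u : 'cV[R]_m) : dot u 0 = 0.
Proof. by rewrite /dot mulmx0 mxE. Qed.

Lemma dot_mulmx m n (A : 'M[R]_(n, m)) (u : 'cV[R]_m) (v : 'cV[R]_n) :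
  dot (A *m u) v = dot u (A^T *m v).
Proof. by rewrite /dot trmx_mul mulmxA. Qed.

Lemma dot_col_mx m1 m2 (u1 v1 : 'cV[R]_m1) (u2 v2 : 'cV[R]_m2) :
  dot (col_mx u1 u2) (col_mx v1 v2) = dot u1 v1 + dot u2 v2.
Proof. by rewrite /dot tr_col_mx mul_row_col mxE. Qed.

Lemma dot_ge0 m (u : 'cV[R]_m) : 0 <= dot u u.
Proof. by rewrite dotE; apply: sumr_ge0 => i _; rewrite -expr2 sqr_ge0. Qed.

Lemma dot_eq0 m (u : 'cV[R]_m) : (dot u u == 0) = (u == 0).
Proof.
apply/idP/eqP => [|->]; last by rewrite dotE big1 // => i _; rewrite mxE mul0r.
rewrite dotE psumr_eq0 => [/allP h|i _]; last by rewrite -expr2 sqr_ge0.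
apply/colP => i; have := h i (mem_index_enum _).
by rewrite -expr2 sqrf_eq0 mxE => /eqP.
Qed.

Lemma dot_gt0 m (u : 'cV[R]_m) : (0 < dot u u) = (u != 0).
Proof. by rewrite lt0r dot_ge0 andbT dot_eq0. Qed.

Lemma cauchy_schwarz m (u v : 'cV[R]_m) :
  dot u v ^+ 2 <= dot u u * dot v v.
Proof.
have [->|v0] := eqVneq v 0.
  by rewrite !dot0r expr0n mulr0.
have vv : 0 < dot v v by rewrite dot_gt0.
(* This vector is [dot v v] times the component of [u] orthogonal to [v]. *)
have := dot_ge0 (dot v v *: u - dot u v *: v).
rewrite dotBr !dotZr !(dotC (_ - _)) !dotBr !dotZr (dotC v u).
nra.
Qed.

Lemma sqr_frobenius m n (A : 'M[R]_(m, n)) :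
  frobenius A ^+ 2 = \sum_i \sum_j A i j ^+ 2.
Proof.
by rewrite sqr_sqrtr // sumr_ge0 // => i _; rewrite sumr_ge0 // => j _;
   rewrite sqr_ge0.
Qed.

Lemma frobenius_ge0 m n (A : 'M[R]_(m, n)) : 0 <= frobenius A.
Proof. exact: sqrtr_ge0. Qed.

Lemma sqr_frobenius_col m (u : 'cV[R]_m) : frobenius u ^+ 2 = dot u u.
Proof.
by rewrite sqr_frobenius dotE; apply: eq_bigr => i _; rewrite big_ord1 expr2.
Qed.

Lemma det_schur_ul m1 m2 (A : 'M[R]_m1) B C (D : 'M[R]_m2) : A \in unitmx ->
  \det (block_mx A B C D) = \det A * \det (D - C *m invmx A *m B).
Proof.
move=> uA; rewrite -(det_ublock A B) -[RHS]mul1r.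
(* Block LU factorization with a unit lower triangular left factor. *)
rewrite -[X in X * _](_ : \det (block_mx 1%:M 0 (C *m invmx A) 1%:M) = 1).
  rewrite -det_mulmx mulmx_block !mul1mx !mul0mx !addr0 mulmxKV //.
  by rewrite addrCA subrr addr0.
by rewrite det_lblock !det1 mulr1.
Qed.

Lemma det_schur_dr m1 m2 (A : 'M[R]_m1) B C (D : 'M[R]_m2) : D \in unitmx ->
  \det (block_mx A B C D) = \det (A - B *m invmx D *m C) * \det D.
Proof.
move=> uD; rewrite -(det_lblock _ C D) -[RHS]mul1r.
rewrite -[X in X * _](_ : \det (block_mx 1%:M (B *m invmx D) 0 1%:M) = 1).
  rewrite -det_mulmx mulmx_block !mul1mx !mul0mx !add0r mulmxKV //.
  by rewrite -addrA addNr addr0.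
by rewrite det_ublock !det1 mulr1.
Qed.

(** One bordered matrix has its determinant expanded by the Schur complement of either diagonal
    block. *)
Lemma det_rank1_update m (A : 'M[R]_m) (u : 'cV[R]_m) e : A \in unitmx ->
  \det (A + e *: (u *m u^T)) = \det A * (1 + e * dot u (invmx A *m u)).
Proof.
move=> uA; transitivity (\det (block_mx 1%:M (- (e *: u^T)) u A)).
  rewrite det_schur_ul ?unitmx1 // det1 mul1r invmx1 mulmx1.
  by rewrite mulmxN opprK -scalemxAr.
rewrite det_schur_dr // mulrC; congr (_ * _).
rewrite !mulNmx opprK -!scalemxAl -mulmxA dot_scalar_mx scale_scalar_mx.
by rewrite -raddfD det_scalar1.
Qed.

(** Sherman-Morrison formula, checked by multiplying by the updated matrix. *)
Lemma invmx_rank1_update m (A : 'M[R]_m) (u : 'cV[R]_m) e : A \in unitmx ->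
  1 + e * dot u (invmx A *m u) != 0 ->
  invmx (A + e *: (u *m u^T)) =
  invmx A - (e / (1 + e * dot u (invmx A *m u))) *:
              (invmx A *m u *m (u^T *m invmx A)).
Proof.
set Y := invmx A; set d := 1 + _ => uA d0.
have uB : A + e *: (u *m u^T) \in unitmx.
  by rewrite unitmxE det_rank1_update // unitfE mulf_neq0 // -unitfE -unitmxE.
rewrite -[RHS](mulKmx uB) -[LHS]mulmx1; congr (_ *m _).
have AW : A *m (Y *m u *m (u^T *m Y)) = u *m (u^T *m Y).
  by rewrite -!mulmxA mulKVmx.
have uW : u *m u^T *m (Y *m u *m (u^T *m Y)) =
          dot u (Y *m u) *: (u *m (u^T *m Y)).
  rewrite -!mulmxA (mulmxA Y) (mulmxA u^T) dot_scalar_mx mul_scalar_mx.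
  by rewrite -scalemxAr.
rewrite mulmxBr !mulmxDl mulmxV // -!scalemxAr -!scalemxAl AW uW -mulmxA.
rewrite -addrA -[LHS]addr0 !scalerA -scalerDl -scalerBl.
congr (_ + _); apply/esym/eqP; rewrite scaler_eq0; apply/orP; left.
by apply/eqP; rewrite /d; field.
Qed.

(** Symmetry is required explicitly, since the quadratic form sees only the symmetric part. *)
Definition posdef m (A : 'M[R]_m) : Prop :=
  A^T = A /\ forall v : 'cV_m, v != 0 -> 0 < dot v (A *m v).

Lemma posdef_ge0 m (A : 'M[R]_m) (v : 'cV_m) :
  posdef A -> 0 <= dot v (A *m v).
Proof.
move=> [_ Apos]; have [->|v0] := eqVneq v 0; last exact/ltW/Apos.
by rewrite mulmx0 dot0r.
Qed.

Lemma posdef_diag_gt0 m (A : 'M[R]_m) i : posdef A -> 0 < A i i.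
Proof.
move=> [_ Apos]; have : delta_mx i 0 != 0 :> 'cV[R]_m.
  by apply/eqP => /colP/(_ i); rewrite !mxE !eqxx => /eqP; rewrite oner_eq0.
by move/Apos; rewrite /dot trmx_delta -rowE -colE !mxE.
Qed.

Lemma posdef_unitmx m (A : 'M[R]_m) : posdef A -> A \in unitmx.
Proof.
move=> [_ Apos]; rewrite -row_free_unit -kermx_eq0; apply/rowV0P => v.
move/sub_kermxP => vA; apply/eqP; apply: contraT => v0.
have /Apos : v^T != 0 by rewrite -(inj_eq trmx_inj) trmxK trmx0.
by rewrite /dot trmxK mulmxA vA mul0mx mxE ltxx.
Qed.

Lemma posdef_invmx m (A : 'M[R]_m) : posdef A -> posdef (invmx A).
Proof.
move=> Apd; have uA := posdef_unitmx Apd; have [As Apos] := Apd.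
split=> [|v v0]; first by rewrite trmx_inv As.
rewrite -[X in dot X _](mulKVmx uA) dotC; apply: Apos.
by apply: contra v0 => /eqP Yv0; rewrite -(mulKVmx uA v) Yv0 mulmx0.
Qed.

Lemma posdef_schur m (A : 'M[R]_(1 + m)) (a := ulsubmx A 0 0) : posdef A ->
  0 < a /\ posdef (drsubmx A - dlsubmx A *m (a^-1 *: ursubmx A)).
Proof.
move=> Apd; have a0 : 0 < a.
  by rewrite /a !mxE; exact: posdef_diag_gt0.
have [As Apos] := Apd; split=> //.
have urE : (ursubmx A)^T = dlsubmx A by rewrite trmx_ursub As.
split=> [|w w0].
  rewrite linearB /= trmx_mul linearZ /= trmx_drsub As urE -urE trmxK.
  by rewrite -scalemxAl -scalemxAr.
(* The first coordinate is chosen to annihilate that of [A *m v], which leaves the quadratic form of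
   the Schur complement at [w]. *)
pose v := col_mx (- (a^-1 *: (ursubmx A *m w))) w.
have v0 : v != 0.
  by apply: contra w0 => /eqP; rewrite -[0]col_mx0 => /eq_col_mx[_ ->].
have := Apos v v0; rewrite -{1}(submxK A) mul_block_col dot_col_mx.
rewrite (mx11_scalar (ulsubmx A)) -/a mul_scalar_mx scalerN scalerA.
rewrite divff ?gt_eqF // scale1r addNr dot0r add0r.
by rewrite mulmxBl mulmxN addrC -mulmxA -scalemxAl.
Qed.

(* Hadamard's inequality, by induction on Schur complements: each one has a
   smaller diagonal. *)
Lemma posdef_det m (A : 'M[R]_m) : posdef A ->
  0 < \det A /\ \det A <= \prod_i A i i.
Proof.
elim: m A => [|m IH] A; first by rewrite det_mx00 big_ord0.
change 'M[R]_(1 + m) in (type of A) => Apd.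
have [a0 Spd] := @posdef_schur m A Apd.
set a := ulsubmx _ _ _ in a0 Spd; set S := (X in posdef X) in Spd.
have detE : \det A = a * \det S.
  rewrite -[A in LHS]submxK.
  rewrite det_schur_ul; last first.
    by rewrite unitmxE det_mx11 unitfE gt_eqF.
  rewrite det_mx11 -/a; congr (_ * \det (_ - _)).
  rewrite (mx11_scalar (ulsubmx A)) -/a invmx_scalar mul_mx_scalar.
  by rewrite -scalemxAl -scalemxAr.
have [S0 Sle] := IH _ Spd.
rewrite detE; split; first exact: mulr_gt0.
rewrite big_ord_recl; have -> : A ord0 ord0 = a.
  by rewrite /a !mxE; congr (A _ _); apply: val_inj.
rewrite ler_pM2l //; apply: (le_trans Sle); apply: ler_prod => i _.
rewrite (ltW (posdef_diag_gt0 i Spd)) /= !mxE big_ord1 !mxE.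
rewrite !(@rshift1 m) ler_wnDr // oppr_le0.
(* By symmetry, the term subtracted from the diagonal is a square over the positive pivot. *)
have -> : A (lshift m 0) (lift ord0 i) = A (lift ord0 i) (lshift m 0).
  by rewrite -[in LHS]Apd.1 mxE.
by rewrite mulrCA -expr2 mulr_ge0 ?sqr_ge0 // invr_ge0 ltW.
Qed.

End LinearAlgebra.

(** * Cost and correctness of the Gram-Schmidt and inversion routines *)

Section Counted.
Variable R : realType.

Lemma cbind1 T U (e : counted T) (f : T -> counted U) :
  (cbind e f).1 = (f e.1).1.
Proof. by []. Qed.

Lemma cbind2 T U (e : counted T) (f : T -> counted U) :
  (cbind e f).2 = (e.2 + (f e.1).2)%N.
Proof. by []. Qed.

Lemma cmx_cost p q (f : 'I_p -> 'I_q -> counted R) k :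
  (forall i j, (f i j).2 = k) -> (cmx f).2 = (p * q * k)%N.
Proof.
move=> fk; rewrite /cmx /= (eq_bigr (fun=> q * k)%N) => [|i _].
  by rewrite sum_nat_const card_ord mulnA.
by rewrite (eq_bigr (fun=> k)) ?sum_nat_const ?card_ord.
Qed.

Lemma csubmx1 p q (A B : 'M[R]_(p, q)) : (csubmx A B).1 = A - B.
Proof. by apply/matrixP => i j; rewrite !mxE. Qed.

Lemma csubmx2 p q (A B : 'M[R]_(p, q)) : (csubmx A B).2 = (p * q)%N.
Proof. by rewrite /csubmx (cmx_cost (k := 1)) ?muln1. Qed.

Lemma cdivmx1 p q (A : 'M[R]_(p, q)) d : (cdivmx A d).1 = d^-1 *: A.
Proof. by apply/matrixP => i j; rewrite !mxE mulrC. Qed.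

Lemma cdivmx2 p q (A : 'M[R]_(p, q)) d : (cdivmx A d).2 = (p * q)%N.
Proof. by rewrite /cdivmx (cmx_cost (k := 1)) ?muln1. Qed.

Lemma cmulmx1 p q r (A : 'M[R]_(p, q)) (B : 'M[R]_(q, r)) :
  (cmulmx A B).1 = A *m B.
Proof. by apply/matrixP => i j; rewrite !mxE. Qed.

Lemma cmulmx2 p q r (A : 'M[R]_(p, q)) (B : 'M[R]_(q, r)) :
  (cmulmx A B).2 = (p * r * (q * 2))%N.
Proof.
by apply: cmx_cost => i j; rewrite /csum /= sum_nat_const card_ord.
Qed.

Definition countedE :=
  (cbind1, cbind2, csubmx1, csubmx2, cdivmx1, cdivmx2, cmulmx1, cmulmx2).

Lemma clq_cost m n (X : 'M[R]_(m, n)) : ((clq X).2 <= (5 * n + 1) * m ^ 2)%N.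
Proof.
elim: m X => [|m IH] X; first by [].
cbn beta iota zeta delta [clq]; rewrite !countedE /=.
set B := (X in clq X); have := IH B; move: (clq B).2 => t; nia.
Qed.

(** Each step splits off a block triangular factor with pivot [rho]; independence of the rows makes
    [rho] nonzero and passes to the remaining rows [B]. *)
Lemma clq_correct m n (X : 'M[R]_(m, n)) : row_free X ->
  exists2 L : 'M[R]_m, L \in unitmx & X = L *m (clq X).1.2.
Proof.
elim: m X => [|m IH] X.
  by exists 1%:M; rewrite ?unitmx1 ?mul1mx.
change 'M[R]_(1 + m, n) in (type of X) => Xfree.
cbn beta iota zeta delta [clq]; rewrite !countedE /=.
set x := usubmx X; set rho := Num.sqrt _; set q := rho^-1 *: x.
set r := _ *m q^T; set B := (X in clq X).
have rho0 : rho != 0.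
  rewrite gt_eqF // sqrtr_gt0 -{1}(trmxK x).
  have := dot_gt0 x^T; rewrite /dot => ->; rewrite -(inj_eq trmx_inj) trmxK.
  apply/eqP; rewrite trmx0 => x0.
  have /(row_free_inj Xfree) : row_mx 1%:M 0 *m X = 0 *m X :> 'rV_n.
    by rewrite -[X]vsubmxK mul_row_col -/x x0 mulmx0 !mul0mx addr0.
  move=> /(congr1 (@lsubmx R 1 1 m)); rewrite row_mxKl linear0.
  move=> /matrixP/(_ 0 0); by rewrite !mxE eqxx => /eqP; rewrite oner_eq0.
have XE : X = block_mx rho%:M 0 r 1%:M *m col_mx q B.
  rewrite -[LHS]vsubmxK mul_block_col mul0mx addr0 mul1mx mul_scalar_mx.
  by rewrite scalerA divff // scale1r addrC subrK.
have uM : block_mx rho%:M 0 r 1%:M \in unitmx.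
  by rewrite unitmxE det_lblock det1 mulr1 det_scalar1 unitfE.
have Bfree : row_free B.
  rewrite -kermx_eq0; apply/rowV0P => v /sub_kermxP vB.
  have /(row_free_inj Xfree) : row_mx 0 v *m invmx (block_mx rho%:M 0 r 1%:M)
                                 *m X = 0 *m X.
    by rewrite XE mulmxA mulmxKV // mul_row_col vB !mul0mx addr0.
  move=> /(congr1 (mulmx^~ (block_mx rho%:M 0 r 1%:M))).
  rewrite mulmxKV // mul0mx => /(congr1 (@rsubmx R 1 1 m)).
  by rewrite row_mxKr linear0.
have [L uL LE] := IH _ Bfree.
have uN : block_mx rho%:M 0 r L \in unitmx.
  by rewrite unitmxE det_lblock det_scalar1 unitrM -unitmxE uL unitfE rho0.
exists (block_mx rho%:M 0 r L); first exact: uN.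
transitivity (block_mx rho%:M 0 r L *m col_mx q (clq B).1.2); last by [].
rewrite mul_block_col mul0mx addr0 -LE {1}XE mul_block_col mul0mx addr0.
by rewrite mul1mx.
Qed.

Lemma cinvmx_cost m (A : 'M[R]_m) : ((cinvmx A).2 <= 7 * m ^ 3)%N.
Proof.
elim: m A => [|m IH] A; first by [].
cbn beta iota zeta delta [cinvmx]; rewrite !countedE /=.
set B := (X in cinvmx X); have := IH B; move: (cinvmx B).2 => t; nia.
Qed.

(** No pivot vanishes, because the Schur complements of a positive definite matrix are again
    positive definite. *)
Lemma cinvmx_correct m (A : 'M[R]_m) : posdef A -> (cinvmx A).1 = invmx A.
Proof.
move=> Apd; suff AK : A *m (cinvmx A).1 = 1%:M.
  by rewrite -[LHS](mulKmx (posdef_unitmx Apd)) AK mulmx1.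
elim: m A Apd => [|m IH] A; first by move=> _; rewrite [LHS]flatmx0 flatmx0.
change 'M[R]_(1 + m) in (type of A) => Apd.
have [a0 Spd] := posdef_schur Apd.
have SK := IH _ Spd.
cbn beta iota zeta delta [cinvmx]; rewrite !countedE /=.
set a := ulsubmx A 0 0 in a0 SK *.
set T := (cinvmx _).1 in SK *.
rewrite -[X in X *m _]submxK (mx11_scalar (ulsubmx A)) -/a.
set b := ursubmx A in SK *; set c := dlsubmx A in SK *.
set D := drsubmx A in SK *.
have DT : D *m T = 1%:M + c *m (a^-1 *: b *m T).
  by rewrite -SK mulmxBl -mulmxA subrK.
set e := 1 / a + _; set u := a^-1 *: b in DT *; set w := a^-1 *: c.
transitivity (block_mx a%:M b c D *m
  block_mx e%:M (0 - u *m T) (0 - T *m w) T); first by [].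
have an0 : a != 0 by rewrite gt_eqF.
have eE : e%:M = a^-1%:M + u *m (T *m w) :> 'M[R]_1.
  by rewrite raddfD /= div1r -mx11_scalar mulmxA.
have bE : b = a *: u by rewrite scalerA divff // scale1r.
have wE : a^-1 *: c = w by [].
clearbody e u w.
rewrite !sub0r mulmx_block !mulmxN !(mulmxA D) DT !mul_scalar_mx bE.
rewrite -!scalemxAl addNr mulmxDl mul1mx eE mulmxDr mul_mx_scalar wE.
rewrite scalerDr scale_scalar_mx divff // addrK -!mulmxA opprD addrCA.
by rewrite addrK addNr addrCA addNr addr0 -scalar_mx_block.
Qed.

End Counted.

(** * Gram matrices and leverages under insertion and removal of an index *)

Section Gram.
Variables (R : realType) (m n : nat).
Implicit Types (X : 'M[R]_(m, n)) (S T : {set 'I_n}).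

(** Written as a sum of rank-one terms, so that inserting or removing an index is a rank-one update;
    [colset_gram] identifies it with X_S X_S^T. *)
Definition gram X S : 'M[R]_m := \sum_(j in S) col j X *m (col j X)^T.

(** The exact value of the score l_j for the set [S]. *)
Definition leverage X S j : R := dot (col j X) (invmx (gram X S) *m col j X).

Lemma colset_gram X S : colset X S *m (colset X S)^T = gram X S.
Proof.
apply/matrixP => a b; rewrite !mxE summxE (big_enum_val (A := mem S)).
by apply: eq_bigr => i _; rewrite !mxE big_ord1 !mxE.
Qed.

Lemma gram_setU1 X S s : s \notin S ->
  gram X (s |: S) = gram X S + 1 *: (col s X *m (col s X)^T).
Proof. by move=> sS; rewrite /gram big_setU1 //= addrC scale1r. Qed.

Lemma gram_setD1 X S r : r \in S ->
  gram X (S :\ r) = gram X S + (-1) *: (col r X *m (col r X)^T).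
Proof.
move=> rS; rewrite /gram [in RHS](big_setD1 r) //= scaleN1r.
by rewrite addrAC subrr add0r.
Qed.

Lemma gram_tr X S : (gram X S)^T = gram X S.
Proof. by rewrite -colset_gram trmx_mul trmxK. Qed.

Lemma gram_mulmx X S v : gram X S *m v =
  \sum_(j in S) dot (col j X) v *: col j X.
Proof.
rewrite mulmx_suml; apply: eq_bigr => j _.
by rewrite -mulmxA dot_scalar_mx mul_mx_scalar.
Qed.

Lemma dot_gram X S v :
  dot v (gram X S *m v) = \sum_(j in S) dot (col j X) v ^+ 2.
Proof.
rewrite gram_mulmx /dot mulmx_sumr summxE; apply: eq_bigr => j _.
by rewrite -scalemxAr mxE -/(dot v _) (dotC v).
Qed.

(** The quadratic form is a sum of squares; if all of them vanish then so does [gram X S *m v], and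
    hence [v]. *)
Lemma gram_posdef X S : gram X S \in unitmx -> posdef (gram X S).
Proof.
move=> uG; split=> [|v v0]; first exact: gram_tr.
rewrite lt0r dot_gram sumr_ge0 ?andbT => [|j _]; last exact: sqr_ge0.
apply: contra v0; rewrite psumr_eq0 => [/allP h|j _]; last exact: sqr_ge0.
rewrite -(mulKmx uG v) gram_mulmx big1 ?mulmx0 // => j jS.
have := h j (mem_index_enum _); rewrite jS sqrf_eq0 => /eqP ->.
by rewrite scale0r.
Qed.

Lemma rank_gram_unitmx X S : \rank (colset X S) = m -> gram X S \in unitmx.
Proof.
by move=> rX; rewrite -colset_gram; apply: gram_unitmx; rewrite /row_free rX.
Qed.

Lemma leverage_ge0 X S j : gram X S \in unitmx -> 0 <= leverage X S j.
Proof. by move=> uG; apply/posdef_ge0/posdef_invmx/gram_posdef. Qed.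

(** The sum is the trace of Y G, the identity of order m. *)
Lemma sum_leverage X S : gram X S \in unitmx ->
  \sum_(j in S) leverage X S j = m%:R.
Proof.
move=> uG; rewrite -(mxtrace1 R m) -(mulVmx uG) {2}/gram mulmx_sumr linear_sum.
apply: eq_bigr => j _ /=; rewrite mulmxA mxtrace_mulC.
by rewrite dot_scalar_mx mxtrace_scalar.
Qed.

Lemma det_gram_setU1 X S s : gram X S \in unitmx -> s \notin S ->
  \det (gram X (s |: S)) = \det (gram X S) * (1 + leverage X S s).
Proof. by move=> uG sS; rewrite gram_setU1 // det_rank1_update // mul1r. Qed.

Lemma det_gram_setD1 X S r : gram X S \in unitmx -> r \in S ->
  \det (gram X (S :\ r)) = \det (gram X S) * (1 - leverage X S r).
Proof. by move=> uG rS; rewrite gram_setD1 // det_rank1_update // mulN1r. Qed.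

Lemma det_gram_gt0 X S : gram X S \in unitmx -> 0 < \det (gram X S).
Proof. by move=> uG; have [] := posdef_det (gram_posdef uG). Qed.

Lemma gram_setU1_unitmx X S s : gram X S \in unitmx -> s \notin S ->
  gram X (s |: S) \in unitmx.
Proof.
move=> uG sS; rewrite unitmxE det_gram_setU1 // unitfE mulf_neq0 ?gt_eqF //.
  exact: det_gram_gt0.
by rewrite ltr_wpDr ?leverage_ge0.
Qed.

(** Indices are inserted one at a time, each multiplying the determinant by 1 + l_s, which is at
    least 1. *)
Lemma det_gram_mono X S T : gram X S \in unitmx -> S \subset T ->
  \det (gram X S) <= \det (gram X T).
Proof.
move: {2}#|T :\: S| (leqnn #|T :\: S|) => d; elim: d S => [|d IH] S.
  rewrite leqn0 cards_eq0 finset.setD_eq0 => TS uG ST.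
  by rewrite (_ : S = T) //; apply/eqP; rewrite finset.eqEsubset ST TS.
move=> leT uG ST; have [TS|] := boolP (T \subset S).
  by rewrite (_ : S = T) //; apply/eqP; rewrite finset.eqEsubset ST TS.
case/fintype.subsetPn => s sT sS.
apply: (@le_trans _ _ (\det (gram X (s |: S)))).
  rewrite det_gram_setU1 // ler_peMr ?(ltW (det_gram_gt0 uG)) //.
  by rewrite lerDl leverage_ge0.
apply: IH; last by rewrite finset.subUset finset.sub1set sT.
  rewrite -ltnS; apply: leq_trans leT; rewrite [X in (_ < X)%N](cardsD1 s).
  by rewrite finset.in_setD sT sS add1n ltnS finset.setUC -finset.setDDl.
exact: gram_setU1_unitmx.
Qed.

Lemma invmx_gram_setU1 X S s (Y := invmx (gram X S)) :
  gram X S \in unitmx -> s \notin S ->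
  invmx (gram X (s |: S)) = Y - (1 + leverage X S s)^-1 *:
    (Y *m col s X *m ((col s X)^T *m Y)).
Proof.
move=> uG sS; rewrite gram_setU1 // invmx_rank1_update ?mul1r ?div1r //.
by rewrite gt_eqF // ltr_wpDr ?leverage_ge0.
Qed.

Lemma invmx_gram_setD1 X S r (Y := invmx (gram X S)) :
  gram X S \in unitmx -> r \in S -> leverage X S r != 1 ->
  invmx (gram X (S :\ r)) = Y + (1 - leverage X S r)^-1 *:
    (Y *m col r X *m ((col r X)^T *m Y)).
Proof.
move=> uG rS r1; rewrite gram_setD1 // invmx_rank1_update // !mulN1r.
  by rewrite scaleNr opprK.
by rewrite subr_eq0 eq_sym.
Qed.

Lemma dot_invmx_gram X S u v :
  dot u (invmx (gram X S) *m v) = dot v (invmx (gram X S) *m u).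
Proof. by rewrite -{1}gram_tr -trmx_inv -dot_mulmx dotC. Qed.

(** Common to insertion and removal: symmetry of [Y] turns the rank-one term into a square. *)
Lemma leverage_rank1 X S (Y' : 'M[R]_m) e s j (Y := invmx (gram X S)) :
  Y' = Y + e *: (Y *m col s X *m ((col s X)^T *m Y)) ->
  dot (col j X) (Y' *m col j X) =
  leverage X S j + e * dot (col s X) (Y *m col j X) ^+ 2.
Proof.
move=> ->; rewrite mulmxDl -scalemxAl dotDr dotZr; congr (_ + _ * _).
rewrite -!mulmxA (mulmxA _ Y) -mulmxA dot_scalar_mx mul_mx_scalar.
by rewrite -scalemxAr dotZr dot_invmx_gram expr2.
Qed.

Lemma leverage_setU1 X S s j : gram X S \in unitmx -> s \notin S ->
  leverage X (s |: S) j = leverage X S j -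
    dot (col s X) (invmx (gram X S) *m col j X) ^+ 2 / (1 + leverage X S s).
Proof.
move=> uG sS; rewrite {1}/leverage.
rewrite (@leverage_rank1 X S _ (- (1 + leverage X S s)^-1) s j).
  by rewrite mulNr [_^-1 * _]mulrC.
by rewrite invmx_gram_setU1 // scaleNr.
Qed.

Lemma leverage_setD1 X S r j : gram X S \in unitmx -> r \in S ->
  leverage X S r != 1 ->
  leverage X (S :\ r) j = leverage X S j +
    dot (col r X) (invmx (gram X S) *m col j X) ^+ 2 / (1 - leverage X S r).
Proof.
move=> uG rS r1; rewrite {1}/leverage.
rewrite (@leverage_rank1 X S _ (1 - leverage X S r)^-1 r j).
  by rewrite [_^-1 * _]mulrC.
by rewrite invmx_gram_setD1.
Qed.

(* Sum the stopping inequality over all candidates for removal: the leverages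
   of the columns of S add up to m, and the squares subtracted from them on
   insertion of s to [leverage X S s]. *)
Lemma stop_leverage X S s (c : R) : gram X S \in unitmx -> s \notin S ->
  (forall i, i \in S ->
    (1 + leverage X S s) * (1 - leverage X (s |: S) i) <= c ^+ 2) ->
  leverage X S s * (#|S|%:R - m%:R + 1) <= m%:R + (c ^+ 2 - 1) * #|S|%:R.
Proof.
move=> uG sS stop; have l0 := leverage_ge0 s uG.
set l := leverage X S s in stop l0 *.
(* The sum is x_s^T Y G Y x_s, and Y G Y = Y. *)
have lE : \sum_(i in S) dot (col s X) (invmx (gram X S) *m col i X) ^+ 2 = l.
  rewrite /l /leverage dotC -[X in dot _ X](mulKVmx uG) dot_gram.
  by apply: eq_bigr => i _; rewrite dot_invmx_gram.
have : \sum_(i in S) (1 + l) * (1 - leverage X (s |: S) i) <=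
       \sum_(i in S) c ^+ 2 by exact: ler_sum.
rewrite sumr_const -mulr_sumr big_split /= sumr_const sumrN.
rewrite (eq_bigr _ (fun i _ => leverage_setU1 i uG sS)).
rewrite sumrB sum_leverage // -mulr_suml lE -/l.
have -> : (1 + l) * (1 *+ #|S| - (m%:R - l / (1 + l))) =
   (1 + l) * (#|S|%:R - m%:R) + l.
  by field; rewrite gt_eqF // ltr_wpDr.
rewrite -mulr_natr; lra.
Qed.

End Gram.

(** * The two norms of X_S^+ X in terms of leverages *)

Section Norms.
Variables (R : realType) (m n : nat).
Implicit Types (X Q : 'M[R]_(m, n)) (L : 'M[R]_m) (S : {set 'I_n}).

Lemma mppinvE p q (A : 'M[R]_(p, q)) P : penrose A P -> mppinv A = P.
Proof. exact: penrose_unique (mppinvP A). Qed.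

(** Full row rank makes A^T (A A^T)^-1 a right inverse of A, from which the Penrose conditions
    follow. *)
Lemma mppinv_colset X S : gram X S \in unitmx ->
  mppinv (colset X S) = (colset X S)^T *m invmx (gram X S).
Proof.
move=> uG; apply: mppinvE.
have AP : colset X S *m ((colset X S)^T *m invmx (gram X S)) = 1%:M.
  by rewrite mulmxA colset_gram mulmxV.
split; first by rewrite AP mul1mx.
- by rewrite -mulmxA AP mulmx1.
- by rewrite AP trmx1.
- by rewrite !trmx_mul trmxK trmx_inv gram_tr mulmxA.
Qed.

Lemma col_mulmx p (L : 'M[R]_(p, m)) X j : col j (L *m X) = L *m col j X.
Proof. by rewrite !colE mulmxA. Qed.

Lemma gram_mulmxl p (L : 'M[R]_(p, m)) X S :
  gram (L *m X) S = L *m gram X S *m L^T.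
Proof.
rewrite /gram mulmx_sumr mulmx_suml; apply: eq_bigr => j _.
by rewrite !colE -!mulmxA trmx_mul !mulmxA.
Qed.

Lemma colset_mulmx L X S : colset (L *m X) S = L *m colset X S.
Proof. by rewrite /colset mulmx_colsub. Qed.

(** Since A A^+ = 1 for A = Q_S, the pseudoinverse of L A is A^+ L^-1, and [L] cancels. *)
Lemma mppinv_mulmx_unitl L Q S : L \in unitmx -> gram Q S \in unitmx ->
  mppinv (colset (L *m Q) S) *m (L *m Q) = mppinv (colset Q S) *m Q.
Proof.
move=> uL uG; rewrite colset_mulmx.
have AP : colset Q S *m mppinv (colset Q S) = 1%:M.
  by rewrite mppinv_colset // mulmxA colset_gram mulmxV.
rewrite (@mppinvE _ _ _ (mppinv (colset Q S) *m invmx L)).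
  by rewrite -mulmxA mulKmx.
have AP' : L *m colset Q S *m (mppinv (colset Q S) *m invmx L) = 1%:M.
  by rewrite mulmxA -(mulmxA L) AP mulmx1 mulmxV.
split; first by rewrite AP' mul1mx.
- by rewrite -mulmxA AP' mulmx1.
- by rewrite AP' trmx1.
- rewrite mulmxA mulmxKV //; by have [] := mppinvP (colset Q S).
Qed.

Lemma dot_mppinv X S v (Y := invmx (gram X S)) : gram X S \in unitmx ->
  dot (mppinv (colset X S) *m v) (mppinv (colset X S) *m v) =
  dot v (Y *m v).
Proof.
move=> uG; rewrite mppinv_colset // -!mulmxA dot_mulmx trmxK mulmxA.
by rewrite colset_gram mulKVmx // dotC.
Qed.

Lemma sqr_frobenius_mppinv X S : gram X S \in unitmx ->
  frobenius (mppinv (colset X S) *m X) ^+ 2 = \sum_j leverage X S j.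
Proof.
move=> uG; rewrite sqr_frobenius exchange_big; apply: eq_bigr => j _.
rewrite /leverage -dot_mppinv // -col_mulmx dotE.
by apply: eq_bigr => i _; rewrite !mxE expr2.
Qed.

(* With a = Y X v, both |M v|^2 = a^T G a and |X^T a|^2 <= (1 + b) a^T G a,
   while a^T G a = (X^T a)^T v. *)
Lemma frobenius_mppinv_mulmx X S (v : 'cV[R]_n) (M := mppinv (colset X S) *m X)
    (b := \sum_(j in ~: S) leverage X S j) : gram X S \in unitmx ->
  frobenius (M *m v) ^+ 2 <= (1 + b) * frobenius v ^+ 2.
Proof.
move=> uG; rewrite !sqr_frobenius_col /M -mulmxA dot_mppinv //.
set Y := invmx _; set a := Y *m (X *m v).
have Ypd := posdef_invmx (gram_posdef uG).
have qE : dot (X *m v) a = dot v (X^T *m a) by rewrite dot_mulmx.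
set q := dot (X *m v) a in qE *; have q0 : 0 <= q by exact: posdef_ge0.
(* Cauchy-Schwarz for the form of [Y], carried to the standard inner product by the
   pseudoinverse. *)
have aE j : dot (col j X) a ^+ 2 <= leverage X S j * q.
  rewrite /leverage /q /a -!dot_mppinv //.
  apply: le_trans (cauchy_schwarz _ _); rewrite mppinv_colset //.
  rewrite -!mulmxA dot_mulmx trmxK mulmxA colset_gram mulKVmx //.
  by rewrite dot_invmx_gram dotC.
have bq : dot (X^T *m a) (X^T *m a) <= (1 + b) * q.
  have -> : dot (X^T *m a) (X^T *m a) = \sum_j dot (col j X) a ^+ 2.
    rewrite dotE; apply: eq_bigr => j _; rewrite expr2.
    suff -> : (X^T *m a) j 0 = dot (col j X) a by [].
    by rewrite dotE mxE; apply: eq_bigr => i _; rewrite !mxE.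
  (* The indices in [S] contribute exactly [q]; [aE] bounds the others. *)
  rewrite (bigID (mem S)) /= -dot_gram mulKVmx // dotC -/q mulrDl mul1r.
  rewrite lerD2l /b mulr_suml (eq_bigl (mem (~: S))) => [|j].
    by apply: ler_sum => j _.
  by rewrite /= inE.
(* The last inequality is obtained after multiplication by [q], so [q = 0] is treated apart. *)
have [->|qn0] := eqVneq q 0.
  rewrite mulr_ge0 ?dot_ge0 // addr_ge0 // sumr_ge0 // => j _.
  exact: leverage_ge0.
have qpos : 0 < q by rewrite lt0r qn0.
rewrite -(ler_pM2l qpos) -expr2 {1}qE.
apply: le_trans (cauchy_schwarz _ _) _.
by rewrite mulrC mulrA [q * _]mulrC ler_wpM2r ?dot_ge0.
Qed.

Lemma frobenius0 p : frobenius (0 : 'cV[R]_p) = 0.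
Proof. by apply/eqP; rewrite -sqrf_eq0 sqr_frobenius_col dot0r. Qed.

Lemma spectral_mppinv X S : gram X S \in unitmx ->
  spectral (mppinv (colset X S) *m X) ^+ 2 <=
  1 + \sum_(j in ~: S) leverage X S j.
Proof.
move=> uG; set b := \sum_(_ in _) _.
have b0 : 0 <= 1 + b.
  by rewrite addr_ge0 // sumr_ge0 // => j _; exact: leverage_ge0.
rewrite /spectral; set E := (X in sup X).
have Eub : ubound E (Num.sqrt (1 + b)).
  move=> _ [v /= v1 <-]; rewrite -(ler_pXn2r (n := 2)) ?nnegrE ?sqrtr_ge0 //.
  rewrite (sqr_sqrtr b0); apply: le_trans (frobenius_mppinv_mulmx _ uG) _.
  by rewrite ler_piMr // expr_le1 ?frobenius_ge0.
(* This element makes the set nonempty and its supremum nonnegative, as comparing squares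
   requires. *)
have E0 : E 0.
  by exists 0; rewrite /= ?mulmx0 frobenius0 ?ler01.
have sup0 : 0 <= sup E by apply: (ub_le_sup _ E0); exists (Num.sqrt (1 + b)).
rewrite -(sqr_sqrtr b0) ler_pXn2r ?nnegrE ?sqrtr_ge0 //.
by apply: ge_sup => //; exists 0.
Qed.

Lemma sum_leverage_setC X S b : (forall j, j \notin S -> leverage X S j <= b) ->
  \sum_(j in ~: S) leverage X S j <= b * (n%:R - #|S|%:R).
Proof.
move=> lb; apply: (@le_trans _ _ (\sum_(j in ~: S) b)).
  by apply: ler_sum => j; rewrite inE; exact: lb.
have -> : \sum_(j in ~: S) b = b * #|~: S|%:R by rewrite sumr_const mulr_natr.
rewrite cardsCs finset.setCK card_ord natrB //.
by rewrite -[leqRHS]card_ord max_card.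
Qed.

(** The leverages over [S] sum to m, the constant term of the Frobenius bound. *)
Lemma norms_mppinv X S b : gram X S \in unitmx ->
  (forall j, j \notin S -> leverage X S j <= b) ->
  frobenius (mppinv (colset X S) *m X) ^+ 2 <= m%:R + b * (n%:R - #|S|%:R) /\
  spectral (mppinv (colset X S) *m X) ^+ 2 <= 1 + b * (n%:R - #|S|%:R).
Proof.
move=> uG /sum_leverage_setC lb; split; last first.
  by apply: le_trans (spectral_mppinv uG) _; rewrite lerD2l.
rewrite sqr_frobenius_mppinv // (bigID (mem S)) /= sum_leverage // lerD2l.
by rewrite (eq_bigl (mem (~: S))) // => j; rewrite /= inE.
Qed.

End Norms.

(** * CPQR residuals and the determinant bound they give *)

Section Cpqr.
Variables (R : realType) (m n : nat) (X : 'M[R]_(m, n)).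
Implicit Types J S : {set 'I_n}.

Let proj J := colset X J *m mppinv (colset X J).

Lemma orth_compE J j : orth_comp X J j = (1%:M - proj J) *m col j X.
Proof. by rewrite mulmxBl mul1mx. Qed.

Lemma orth_comp_mem J j : j \in J -> orth_comp X J j = 0.
Proof.
move=> jJ; rewrite /orth_comp.
have -> : col j X = colset X J *m delta_mx (enum_rank_in jJ j) 0.
  by apply/colP => i; rewrite -colE !mxE enum_rankK_in.
by rewrite mulmxA; have [-> _ _ _] := mppinvP (colset X J); rewrite subrr.
Qed.

(** The projector is symmetric and annihilates residuals, so the projected part of [col j X]
    contributes nothing. *)
Lemma dot_orth_comp J i j :
  dot (orth_comp X J i) (orth_comp X J j) = dot (orth_comp X J i) (col j X).
Proof.
have [PA _ Ps _] := mppinvP (colset X J).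
rewrite {2}/orth_comp dotBr [X in _ - X](_ : _ = 0) ?subr0 //.
rewrite -/(proj J) -[proj J]trmxK -dot_mulmx [(proj J)^T]Ps orth_compE.
by rewrite mulmxA mulmxBr mulmx1 /proj mulmxA PA subrr mul0mx dotC dot0r.
Qed.

(** If the largest residual were zero, all columns of [X] would lie in the range of [colset X J], of
    rank at most [#|J|]. *)
Lemma orth_comp_gt0 J s : (#|J| < \rank X)%N -> s \notin J ->
  (forall j, j \notin J ->
     frobenius (orth_comp X J j) <= frobenius (orth_comp X J s)) ->
  0 < dot (orth_comp X J s) (orth_comp X J s).
Proof.
move=> ltJ sJ smax; rewrite dot_gt0; apply: contraTneq ltJ => os0.
have o0 j : orth_comp X J j = 0.
  have [/orth_comp_mem //|/smax] := boolP (j \in J).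
  rewrite os0 frobenius0 => le0; apply/eqP; rewrite -dot_eq0.
  rewrite -sqr_frobenius_col sqrf_eq0 eq_le le0.
  exact: frobenius_ge0.
have -> : X = proj J *m X.
  apply/matrixP => a j; have /colP/(_ a) := o0 j.
  rewrite /orth_comp -col_mulmx [LHS]mxE [X in _ + X]mxE [col j X a 0]mxE.
  by rewrite [col _ _ _ _]mxE [RHS]mxE => /eqP; rewrite subr_eq0 => /eqP.
rewrite -leqNgt /proj -mulmxA; apply: leq_trans (mxrankM_maxl _ _) _.
exact: rank_leq_col.
Qed.

(* The rows of U are the normals [orth_comp J s], divided by their squared
   norms: on the selected columns U X is unitriangular, and the greedy choice
   of s bounds all of its entries. *)
Lemma cpqr_scaling t J : cpqr X t J -> (t <= \rank X)%N ->
  #|J| = t /\ exists U : 'M[R]_(t, m),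
    (forall i j, (U *m X) i j ^+ 2 <= 1) /\
    \det (U *m gram X J *m U^T) = 1.
Proof.
elim=> [|{}t {}J s _ IH sJ smax] tr.
  split; first by rewrite finset.cards0.
  by exists 0; split=> [[]//|]; rewrite det_mx00.
have [Jt [U [UX detU]]] := IH (ltnW tr).
split; first by rewrite cardsU1 sJ Jt.
set o := orth_comp X J; set rho := dot (o s) (o s).
have rho0 : 0 < rho by apply: orth_comp_gt0; rewrite ?Jt.
set u := rho^-1 *: (o s)^T.
have uE j : u *m col j X = (dot (o s) (o j) / rho)%:M.
  by rewrite -scalemxAl dot_scalar_mx scale_scalar_mx dot_orth_comp mulrC.
suff [U'X detU'] : (forall i j, (col_mx u U *m X) i j ^+ 2 <= 1) /\
    \det (col_mx u U *m gram X (s |: J) *m (col_mx u U)^T) = 1.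
  by exists (col_mx u U).
split=> [i j|].
  rewrite mul_col_mx; case: (split_ordP i) => i' ->.
    rewrite col_mxEu ord1.
    have -> : (u *m X) 0 j = dot (o s) (o j) / rho.
      have /matrixP/(_ 0 0) := uE j; rewrite [RHS]mxE eqxx mulr1n => <-.
      by rewrite !mxE; apply: eq_bigr => k _; rewrite !mxE.
    (* The greedy choice covers the unselected indices; the residuals of the selected ones are
       zero. *)
    have oj : dot (o j) (o j) <= rho.
      have [/orth_comp_mem|/smax] := boolP (j \in J).
        by rewrite -/(o j) => ->; rewrite dot0r ltW.
      rewrite -/(o j) -/(o s) -(ler_pXn2r (n := 2)) ?nnegrE ?frobenius_ge0 //.
      by rewrite !sqr_frobenius_col.
    rewrite expr_div_n ler_pdivrMr ?exprn_gt0 // mul1r.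
    by apply: le_trans (cauchy_schwarz _ _) _; rewrite expr2 ler_wpM2l // ltW.
  by rewrite col_mxEd.
have uG : u *m gram X J = 0.
  rewrite /gram mulmx_sumr big1 // => j jJ.
  by rewrite mulmxA uE /o (orth_comp_mem jJ) dot0r mul0r mul_scalar_mx scale0r.
have us : u *m col s X = 1%:M by rewrite uE divff // gt_eqF.
rewrite gram_setU1 // scale1r mulmxDr mulmxDl.
rewrite mul_col_mx uG.
(* As [u] kills [gram X J] and [u *m col s X] is 1, the corner is 1 and its Schur complement cancels
   what [s] adds to the lower right block. *)
have -> : col_mx u U *m (col s X *m (col s X)^T) *m (col_mx u U)^T =
    block_mx 1%:M (U *m col s X)^T (U *m col s X)
      (U *m col s X *m (U *m col s X)^T).
  rewrite mulmxA -mulmxA -trmx_mul !mul_col_mx us tr_col_mx trmx1.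
  by rewrite mul1mx mul_mx_row mulmx1.
rewrite tr_col_mx mul_col_row !mul0mx add_block_mx !add0r.
have -> : U *m gram X J *m u^T = 0.
  by rewrite -mulmxA -(gram_tr X J) -trmx_mul uG trmx0 mulmx0.
rewrite add0r det_schur_ul ?unitmx1 // det1 mul1r invmx1 mulmx1.
by rewrite addrK.
Qed.

(* Hadamard's inequality for the rescaled Gram matrix of S, whose diagonal
   entries are sums of #|S| squares at most 1. *)
Lemma cpqr_det_gram I S0 S : \rank X = m -> cpqr X m I -> I \subset S0 ->
  gram X S \in unitmx ->
  \det (gram X S) <= #|S|%:R ^+ m * \det (gram X S0).
Proof.
move=> rX cI IS0 uG; have := cpqr_scaling cI; rewrite rX => /(_ (leqnn m)).
case=> _ [U [UX]]; rewrite !det_mulmx det_tr => detI.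
have dI0 : \det (gram X I) != 0.
  by apply/eqP => d0; move/eqP: detI; rewrite d0 mulr0 mul0r eq_sym oner_eq0.
have uI : gram X I \in unitmx by rewrite unitmxE unitfE.
have dU0 : \det U != 0.
  by apply/eqP => d0; move/eqP: detI; rewrite d0 !mul0r eq_sym oner_eq0.
have uUG : gram (U *m X) S \in unitmx.
  by rewrite gram_mulmxl unitmxE !det_mulmx det_tr unitfE !mulf_neq0 //
             -unitfE -unitmxE.
have [_ had] := posdef_det (gram_posdef uUG).
have {}had : \det (gram (U *m X) S) <= #|S|%:R ^+ m.
  apply: le_trans had _; rewrite -[m in leRHS]card_ord -prodr_const.
  apply: ler_prod => i _; rewrite -colset_gram mxE.
  have -> : \sum_j colset (U *m X) S i j * (colset (U *m X) S)^T j i =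
            \sum_(j in S) (U *m X) i j ^+ 2.
    rewrite (big_enum_val (A := mem S)); apply: eq_bigr => j _.
    by rewrite [_^T j i]mxE -expr2 mxE.
  rewrite sumr_ge0 => [|j _]; last exact: sqr_ge0.
  by rewrite -sumr_const; apply: ler_sum => j _; exact: UX.
(* The bound passes through [I]: scaling by [U] divides Gram determinants by [\det (gram X I)], and
   [I] lies in [S0]. *)
apply: (@le_trans _ _ (#|S|%:R ^+ m * \det (gram X I))); last first.
  by rewrite ler_wpM2l ?exprn_ge0 // det_gram_mono.
have -> : \det (gram X S) = \det (gram (U *m X) S) * \det (gram X I).
  rewrite gram_mulmxl !det_mulmx det_tr -[LHS]mulr1 -detI; ring.
by rewrite ler_wpM2r // ltW // det_gram_gt0.
Qed.

End Cpqr.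

(** * Loop invariant, cost of one pass, termination and growth of the determinant *)

Section Loop.
Variables (R : realType) (m n : nat).
Implicit Types (X : 'M[R]_(m, n)) (S : {set 'I_n}) (st : state R m n).

(** The loop invariant; invertibility of the Gram matrix stands for full row rank of the selected
    columns. *)
Definition valid X k st : Prop :=
  [/\ #|indices st| = k, gram X (indices st) \in unitmx,
      invgram st = invmx (gram X (indices st))
    & forall j, lev st 0 j = leverage X (indices st) j].

Lemma mulmx_col00 p (A : 'M[R]_(p, m)) X i j :
  (A *m X) i j = (A *m col j X) i 0.
Proof. by rewrite -col_mulmx [RHS]mxE. Qed.

(** With [L] the identity when no LQ step is made, one factorization of [X] covers both variants. *)
Lemma start_valid lq X S (init := start lq X S) : \rank X = m ->
  \rank (colset X S) = m ->
  exists2 L : 'M[R]_m, L \in unitmx &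
    X = L *m init.1.1 /\ valid init.1.1 #|S| init.1.2.
Proof.
move=> rX rS; pose Q := if lq then (clq X).1.2 else X.
have [L uL LE] : exists2 L : 'M[R]_m, L \in unitmx & X = L *m Q.
  rewrite /Q; case: (lq).
    by apply: clq_correct; rewrite /row_free rX.
  by exists 1%:M; rewrite ?unitmx1 ?mul1mx.
exists L => //; have QE : init.1.1 = Q by rewrite /init /Q /start; case: (lq).
rewrite QE; split=> //.
have uG : gram Q S \in unitmx.
  have := rank_gram_unitmx rS; rewrite LE gram_mulmxl !unitmxE !det_mulmx.
  by rewrite !unitrM => /andP[/andP[]].
rewrite /init /start !cbind1.
have -> : (if lq then let* LQ := clq X in cret LQ.2 else cret X).1 = Q.
  by rewrite /Q; case: (lq).
rewrite cmulmx1 colset_gram cinvmx_correct; last exact: gram_posdef.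
split=> // j; rewrite [LHS]mxE !cbind1 !cmulmx1 //.
Qed.

(** As [m <= n], the cubic cost of the inversion is absorbed into [n * m ^ 2]. *)
Lemma start_cost lq X S : (m <= n)%N -> ((start lq X S).2 <= 20 * n * m ^ 2)%N.
Proof.
move=> mn; rewrite /start !cbind2.
set e := if lq then _ else _; set Q := e.1; rewrite cmulmx2.
have := cinvmx_cost (cmulmx (colset Q S) (colset Q S)^T).1.
move: (cinvmx _).2 => t le_t.
rewrite (cmx_cost (k := m * 1 * (m * 2) + (1 * 1 * (m * 2) + 0))); last first.
  by move=> i j; rewrite !countedE.
have le_S : (#|S| <= n)%N by rewrite -[n in leqRHS]card_ord max_card.
have : (e.2 <= (5 * n + 1) * m ^ 2)%N.
  by rewrite /e; case: (lq) => //=; rewrite addn0; exact: clq_cost.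
move: e.2 => a le_a; move: le_S le_t; rewrite /=.
nia.
Qed.

Lemma insert_valid X k st s : valid X k st -> s \notin indices st ->
  (forall j, (insert X st s).1.1 0 j = leverage X (s |: indices st) j) /\
  (insert X st s).1.2 = invmx (gram X (s |: indices st)).
Proof.
case=> _ uG YE lE sS; split=> [j|].
  cbn beta iota zeta delta [insert]; rewrite !countedE mxE /= lE lE.
  rewrite leverage_setU1 // YE mulmx_col00 -mulmxA -/(dot _ _) -expr2.
  by [].
cbn beta iota zeta delta [insert]; rewrite !countedE lE YE.
by rewrite invmx_gram_setU1.
Qed.

Lemma insert_cost X st s :
  (insert X st s).2 = (1 + 8 * m ^ 2 + 2 * n * m + 3 * n)%N.
Proof.
cbn beta iota zeta delta [insert]; rewrite !countedE (cmx_cost (k := 3)) //=.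
nia.
Qed.

Lemma remove_cost X S (l' : 'rV[R]_n) Y' s r :
  (remove X S l' Y' s r).2 = (1 + 8 * m ^ 2 + 2 * n * m + 3 * n)%N.
Proof.
cbn beta iota zeta delta [remove]; rewrite !countedE (cmx_cost (k := 3)) //.
rewrite (cmx_cost (k := 1)) //=; nia.
Qed.

(** The strict bound on the leverage of [r] keeps the Gram matrix invertible after removal. *)
Lemma remove_valid X k S (l' : 'rV[R]_n) s r (T := s |: S) :
  s \notin S -> r \in S -> #|S| = k -> gram X T \in unitmx ->
  leverage X T r < 1 ->
  (forall j, l' 0 j = leverage X T j) ->
  valid X k (remove X S l' (invmx (gram X T)) s r).1 /\
  indices (remove X S l' (invmx (gram X T)) s r).1 = T :\ r.
Proof.
move=> sS rS Sk uG r1 lE; split=> //.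
have rT : r \in T by rewrite !inE rS orbT.
have rn1 : leverage X T r != 1 by rewrite lt_eqF.
have uG' : gram X (T :\ r) \in unitmx.
  rewrite unitmxE det_gram_setD1 // unitfE mulf_neq0 ?gt_eqF ?det_gram_gt0 //.
  by rewrite subr_gt0.
split=> //.
- have := cardsD1 r T; rewrite rT cardsU1 sS Sk => /eqP.
  by rewrite eqn_add2l => /eqP.
- cbn beta iota zeta delta [remove]; rewrite !countedE lE /=.
  rewrite invmx_gram_setD1 //; by apply/matrixP => i j; rewrite !mxE.
- move=> j; cbn beta iota zeta delta [remove]; rewrite !countedE mxE /= !lE.
  by rewrite leverage_setD1 // mulmx_col00 -mulmxA -/(dot _ _) -expr2.
Qed.

(** The inequality of [stop_leverage] solved for the score of [s]; it is the factor of n - k in both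
    norm bounds. *)
Definition leverage_bound (c : R) k : R :=
  (m%:R + (c ^+ 2 - 1) * k%:R) / (k%:R - m%:R + 1).

(** When the stopping test succeeds, minimality of [r] extends it to all of [S], as [stop_leverage]
    demands, and maximality of [s] carries the bound to every outside index. *)
Lemma iterationP X c k st out N : 1 <= c -> (0 < m)%N -> (m <= n)%N ->
  (m <= k)%N -> valid X k st ->
  iteration X c st out N ->
  (N <= 40 * n * m)%N /\
  match out with
  | inl T => T = indices st /\
      forall j, j \notin T -> leverage X T j <= leverage_bound c k
  | inr st' => valid X k st' /\
      c ^+ 2 * \det (gram X (indices st)) < \det (gram X (indices st'))
  end.
Proof.
move=> c1 m0 mn mk vst; rewrite /iteration; have [ST [-> ->]|_] := eqVneq.
  split; first by nia.
  by split=> // j; rewrite ST inE.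
have [Sk uG YE lE] := vst; set S := indices st in Sk uG YE lE *.
case=> s [r [[sS smax] [rS rmin] bE]].
rewrite finset.in_setC in sS.
have [l'E Y'E] := insert_valid vst sS; rewrite -/S in l'E Y'E.
pose stops := (1 + leverage X S s) * (1 - leverage X (s |: S) r) <= c ^+ 2.
(* The body in terms of exact leverages: each [n] standing alone is a selection scan, and [5] counts
   the operations of the stopping test. *)
have bE2 : body X c st s r =
  (if stops then inl S
   else inr (remove X S (insert X st s).1.1 (invmx (gram X (s |: S))) s r).1,
   (n + (1 + 8 * m ^ 2 + 2 * n * m + 3 * n) + n + 5 +
    if stops then 0 else 1 + 8 * m ^ 2 + 2 * n * m + 3 * n)%N).
  rewrite /stops.
  have := insert_cost X st s.
  rewrite -lE -l'E -Y'E expr2 /body -/S.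
  case: (insert X st s) => -[l' Y'] t.
  cbv beta iota zeta delta [fst snd cbind ctick Defs.cadd csub cmul cle] => ->.
  have := remove_cost X S l' Y' s r.
  case: (remove X S l' Y' s r) => st1 t1. cbn [fst snd] => ->.
  by rewrite /cbind /=; case: ifP => _ /=; congr pair; lia.
move: bE; rewrite bE2 /stops; case: leP => stop [-> ->]; split; try by nia.
  split=> // j jS.
  have l_s : leverage X S s <= leverage_bound c k.
    rewrite ler_pdivlMr; last by rewrite ltr_wpDl // subr_ge0 ler_nat.
    rewrite -Sk; apply: stop_leverage => // i iS; apply: le_trans stop.
    rewrite ler_wpM2l ?addr_ge0 ?leverage_ge0 // lerD2l lerN2 -!l'E.
    exact: rmin.
  by apply: le_trans l_s; rewrite -!lE; apply: smax; rewrite inE.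
have l0 : 0 < 1 + leverage X S s by rewrite ltr_wpDr ?leverage_ge0.
(* The product exceeds [c ^+ 2], which is nonnegative, and its first factor is positive. *)
have r1 : leverage X (s |: S) r < 1.
  rewrite -subr_gt0 -(pmulr_rgt0 _ l0); apply: le_lt_trans stop.
  exact: sqr_ge0.
have uG' := gram_setU1_unitmx uG sS.
have [vst' ->] := remove_valid sS rS Sk uG' r1 l'E; split=> //.
rewrite det_gram_setD1 ?det_gram_setU1 // ?inE ?rS ?orbT //.
by rewrite -mulrA mulrC ltr_pM2l ?det_gram_gt0.
Qed.

Lemma iteration_exists X c k st : (0 < k)%N -> valid X k st ->
  exists out N, iteration X c st out N.
Proof.
move=> k0 [Sk _ _ _]; rewrite /iteration; have [ST|SnT] := eqVneq.
  by exists (inl (indices st)), n.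
have [s0 s0S] : exists s0, s0 \in ~: indices st.
  apply/set0Pn; apply: contra SnT.
  by rewrite -finset.setCT (inj_eq (can_inj (@finset.setCK _))).
have [r0 r0S] : exists r0, r0 \in indices st.
  by apply/set0Pn; rewrite -card_gt0 Sk.
pose s := [arg max_(s > s0 in ~: indices st) lev st 0 s]%O.
pose r := [arg min_(r < r0 in indices st) (insert X st s).1.1 0 r]%O.
exists (body X c st s r).1, (body X c st s r).2, s, r; split.
- by rewrite /s; case: arg_maxP => // i iS imax; split.
- by rewrite /r; case: arg_minP => // i iS imin; split.
- by case: (body _ _ _ _ _).
Qed.

(** The termination measure is the number of index sets with a larger Gram determinant, which drops
    at every swap. *)
Lemma loop_halts_valid X c k st : 1 <= c -> (0 < m)%N -> (m <= n)%N ->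
  (m <= k)%N -> valid X k st -> loop_halts X c st.
Proof.
move=> c1 m0 mn mk; pose above st :=
  [set T : {set 'I_n} | \det (gram X (indices st)) < \det (gram X T)].
have [d] := ubnP #|above st|; elim: d st => [|d IH] st.
  by rewrite ltn0.
rewrite ltnS => le_d vst; split.
  by apply: iteration_exists vst; apply: leq_trans mk.
move=> st' N /(iterationP c1 m0 mn mk vst)[_ [vst' lt_det]].
have {}lt_det : \det (gram X (indices st)) < \det (gram X (indices st')).
  apply: le_lt_trans lt_det; rewrite ler_peMl ?expr_ge1 //.
    by have [_ uG _ _] := vst; exact/ltW/det_gram_gt0.
  exact: le_trans c1.
apply: IH => //; apply: leq_trans le_d; apply: proper_card.
apply/properP; split.
  by apply/fintype.subsetP => T; rewrite !inE; apply: lt_trans.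
by exists (indices st'); rewrite !inE ?ltxx.
Qed.

(** Here [p] is the number of swaps; the final, returning pass accounts for [p.+1]. *)
Lemma loopP X c k st S N : 1 <= c -> (0 < m)%N -> (m <= n)%N -> (m <= k)%N ->
  loop X c st S N -> valid X k st ->
  [/\ gram X S \in unitmx, #|S| = k,
      forall j, j \notin S -> leverage X S j <= leverage_bound c k
    & exists2 p, (N <= p.+1 * (40 * n * m))%N &
        c ^+ (2 * p) * \det (gram X (indices st)) <= \det (gram X S)].
Proof.
move=> c1 m0 mn mk; elim=> {st S N} [st S N it vst|st S st' N N' it _ IH vst].
  have [leN [-> lb]] := iterationP c1 m0 mn mk vst it.
  have [Sk uG _ _] := vst; split=> //; exists 0; first by rewrite mul1n.
  by rewrite mul1r.
have [leN [vst' lt_det]] := iterationP c1 m0 mn mk vst it.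
have [uG Sk lb [p leN' le_det]] := IH vst'; split=> //.
exists p.+1; first by rewrite [leqRHS]mulSn leq_add.
apply: le_trans le_det; rewrite mulnS addnC exprD -mulrA.
by rewrite ler_wpM2l ?exprn_ge0 ?(le_trans _ c1) // ltW.
Qed.

End Loop.

(** * Counting the swaps and assembling the bounds *)

Lemma exponent_le_log (R : realType) (c : R) p m k :
  1 < c -> (0 < k)%N -> c ^+ (2 * p) <= k%:R ^+ m ->
  p%:R <= m%:R * Num.max 1 (log_base c k%:R).
Proof.
move=> c1 k0 le_ck; have c0 : 0 < c by apply: lt_trans c1.
have lnc : 0 < ln c by apply: ln_gt0.
have kR : 0 < k%:R :> R by rewrite ltr0n.
have : ln (c ^+ (2 * p)) <= ln (k%:R ^+ m) by rewrite ler_ln ?posrE ?exprn_gt0.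
rewrite !lnXn // -[ln c *+ _]mulr_natl -[_ *+ m]mulr_natl => le_ln.
apply: (@le_trans _ _ (m%:R * log_base c k%:R)); last first.
  by rewrite ler_wpM2l // le_max lexx orbT.
(* The factor 2 of the exponent is given up here. *)
rewrite /log_base mulrA ler_pdivlMr //; apply: le_trans le_ln.
by rewrite ler_wpM2r ?(ltW lnc) // ler_nat leq_pmull.
Qed.

(** [C] is chosen before all other data, hence uniform in them. The maximum with 1 covers [k < c],
    where the logarithm is below 1 but the start and one pass still have to be paid for. *)
Theorem theorem1 (R : realType) :
  exists C : R,
  forall (m n k : nat) (X : 'M[R]_(m, n)) (S0 : {set 'I_n}) (c : R) (lq : bool),
    (0 < m)%N -> (m <= n)%N -> \rank X = m -> 1 <= c ->
    #|S0| = k -> (m <= k)%N -> \rank (colset X S0) = m ->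
    dominant_split_halts lq X S0 c /\
    forall (S : {set 'I_n}) (N : nat), dominant_split lq X S0 c S N ->
      let B := (m%:R + (c ^+ 2 - 1) * k%:R) / (k%:R - m%:R + 1)
                 * (n%:R - k%:R) in
      [/\ frobenius (mppinv (colset X S) *m X) ^+ 2 <= m%:R + B,
          spectral (mppinv (colset X S) *m X) ^+ 2 <= 1 + B
        & 1 < c ->
          (exists2 I : {set 'I_n}, cpqr X m I & I \subset S0) ->
          N%:R <= C * (n%:R * m%:R ^+ 2 * Num.max 1 (log_base c k%:R))].
Proof.
(* 100 = 20 + 2 * 40: the start costs at most 20 n m^2, each pass at most 40 n m, and there are at
   most p + 1 <= 2 m M passes, M being the maximum in the bound. *)
exists 100%:R => m n k X S0 c lq m0 mn rX c1 S0k mk rS0.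
have [L uL [XE vinit]] := start_valid lq rX rS0; rewrite S0k in vinit.
have indices0 : indices (start lq X S0).1.2 = S0 by [].
split; first exact: loop_halts_valid vinit.
move=> S N [N' loopS ->].
have [uG Sk lb [p leN' le_det]] := loopP c1 m0 mn mk loopS vinit.
have start_le := start_cost lq X S0 mn.
rewrite indices0 in le_det vinit; have [_ uG0 _ _] := vinit.
move: loopS leN' start_le => _.
move: (start lq X S0).2 => N0 leN' leN0.
move: (start lq X S0).1.1 => Q in XE uG uG0 lb le_det *.
have SkR : #|S|%:R = k%:R :> R by rewrite Sk.
have [frob spec] := norms_mppinv uG lb.
rewrite SkR -(mppinv_mulmx_unitl uL uG) -XE in frob spec.
split=> // {}c1 [I cI IS0].
have uGX : gram X S \in unitmx.
  by rewrite XE gram_mulmxl !unitmx_mul unitmx_tr uL uG.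
have := cpqr_det_gram rX cI IS0 uGX.
rewrite XE !gram_mulmxl !det_mulmx det_tr Sk => le_det'.
have dL : \det L != 0 by rewrite -unitfE -unitmxE.
(* CPQR concerns [X] while the loop works on [Q]; their Gram determinants differ by the common
   factor [\det L ^+ 2]. *)
have {}le_det' : \det (gram Q S) <= k%:R ^+ m * \det (gram Q S0).
  have dL2 : 0 < \det L ^+ 2 by rewrite exprn_even_gt0.
  by rewrite -(ler_pM2l dL2); lra.
have k0 : (0 < k)%N by apply: leq_trans mk.
have le_ck : c ^+ (2 * p) <= k%:R ^+ m.
  rewrite -(ler_pM2r (det_gram_gt0 uG0)); exact: le_trans le_det'.
have := exponent_le_log c1 k0 le_ck.
set M := Num.max _ _; have M1 : 1 <= M by rewrite le_max lexx.
move=> le_p.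
have m1 : 1 <= m%:R :> R by rewrite ler1n.
have n0 : 0 <= n%:R :> R by [].
have : (N0 + N')%:R <= (20 * n * m ^ 2 + p.+1 * (40 * n * m))%:R :> R.
  by rewrite ler_nat leq_add.
rewrite -[p.+1]addn1 !(natrD, natrM, natrX).
move=> leN; apply: (le_trans leN).
have le_p1 : p%:R + 1 <= 2%:R * (m%:R * M) by nra.
have nm : 0 <= n%:R * m%:R :> R by rewrite mulr_ge0.
have := ler_wpM2r nm le_p1.
have := ler_wpM2l (mulr_ge0 nm (ler0n R m)) M1.
nra.
Qed.
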